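(* Let $A\in\mathbb{R}^{m\times d}$, $b\in\mathbb{R}^m$ and a convex set $\mathcal{K}\subseteq\mathbb{R}^d$ be given, and let $\rho\ge \max_{x\in\mathcal{K}}\|Ax-b\|_\infty$. Let $0<\alpha\le 9\rho$ and $\beta\in(0,1)$, and let $s\in\mathbb{N}$. Suppose the linear feasibility problem ''find $x\in\mathcal{K}$ with $Ax\le b$'' has a feasible solution. Then, with probability at least $1-\beta$, the Dense-MW LP algorithm (described in the context) with density parameter $s$, run with an $(\alpha/3,\beta/T)$-approximate, $\rho$-bounded oracle, outputs a point $\bar x\in\mathcal{K}$ for which there is a set $S\subseteq[m]$ of constraints with $|S|<s$ such that $A_i\bar x\le b_i+\alpha$ for every $i\notin S$.
   Context: Notation: $A_i$ is the $i$-th row of $A$. For a measure $A$ on a finite set $\mathcal{A}$ (a function $\mathcal{A}\to[0,1]$) write $|A|=\sum_{a}A_a$. For $s>0$ and a measure $A$ with $|A|\le s$, the Bregman projection of $A$ onto the set of $1/s$-dense distributions is the distribution $\Pi_s(A)$ with $\Pi_s(A)_a=\frac1s\min\{1,cA_a\}$, where $c\ge0$ is chosen so that $\sum_a\min\{1,cA_a\}=s$. Dense multiplicative weights $DMW_{s,\eta}$ over $\mathcal{A}$: start with $A^1$ the uniform measure on $\mathcal{A}$; for $t=1,\dots,T$: let $\tilde B^t=\Pi_s(A^t)$, receive a loss vector $\ell^t$ (possibly depending on the past), and set $A^{t+1}_a=e^{-\eta\ell^t_a}A^t_a$ for all $a$. An $(\alpha,\beta)$-approximate, $\rho$-bounded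 oracle is a (randomized) procedure that, given a distribution $y\in\mathbb{R}^m$ and the matrix $A$, with probability at least $1-\beta$ outputs $x^*\in\mathcal{K}$ with $\sum_i y_i(A_i\cdot x^* )\le\min_{x\in\mathcal{K}}\sum_i y_i(A_i\cdot x)+\alpha$ and $\|Ax^*-b\|_\infty\le\rho$. Dense-MW LP algorithm (density parameter $s$, accuracy $\alpha$, width $\rho$): set $T=36\rho^2\log m/\alpha^2$ and $\eta=\sqrt{\log m/T}$; let $\tilde y^1$ be the uniform distribution on $[m]$. For $t=1,\dots,T$: compute $x^t=\mathrm{Oracle}(\tilde y^t,A)$; set losses $\ell^t_i=\frac{1}{2\rho}(b_i-A_i\cdot x^t)+\frac12$; obtain $\tilde y^{t+1}$ from the dense multiplicative weights algorithm $DMW_{s,\eta}$ over $\mathcal{A}=[m]$ with these losses (i.e. $\tilde y^{t+1}$ is the projected distribution $\tilde B^{t+1}$). Output $\bar x=\frac1T\sum_{t=1}^T x^t$. *)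

(* Defs.v *)
From HB Require Import structures.
From mathcomp Require Export all_boot all_order all_algebra.
From mathcomp Require Export all_classical all_reals all_analysis.
Export Order.TTheory GRing.Theory Num.Theory.
Export numFieldNormedType.Exports.

Set Implicit Arguments.
Unset Strict Implicit.
Unset Printing Implicit Defensive.

Local Open Scope classical_set_scope.
Local Open Scope ring_scope.

(* R^n carries the product (= Borel) sigma-algebra, generated by the
   coordinates; the library has this for tuples but not for vectors. *)
Section measurable_cV.
Context {R : realType} (n : nat).

Let coord (i : 'I_n) (v : 'cV[R]_n) : measurableTypeR R := v i 0.

Let cV_set0 : g_sigma_preimage coord set0.
Proof. exact: sigma_algebra0. Qed.

Let cV_setC A : g_sigma_preimage coord A -> g_sigma_preimage coord (~` A).
Proof. exact: sigma_algebraC. Qed.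

Let cV_bigcup (F : (set 'cV[R]_n)^nat) :
  (forall i, g_sigma_preimage coord (F i)) ->
  g_sigma_preimage coord (\bigcup_i (F i)).
Proof. exact: sigma_algebra_bigcup. Qed.

HB.instance Definition _ := @isMeasurable.Build default_measure_display
  'cV[R]_n (g_sigma_preimage coord) cV_set0 cV_setC cV_bigcup.

End measurable_cV.

Section bregman.
Context {R : realType} {m : nat}.
Implicit Types (A y l : 'cV[R]_m) (s : nat) (eta : R).

Definition is_distr y := (forall i, 0 <= y i 0) /\ \sum_i y i 0 = 1.

Definition uniform_distr : 'cV[R]_m := const_mx (m%:R^-1).

(* When A has positive entries, a suitable c exists iff s <= m; it may fail to
   be unique only if s = m, and then all choices give the same projection. *)
Definition bregman_scale s A : R :=
  xget 0 [set c | 0 <= c /\ \sum_a Num.min 1 (c * A a 0) = s%:R].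

Definition bregman_proj s A : 'cV[R]_m :=
  \col_a (s%:R^-1 * Num.min 1 (bregman_scale s A * A a 0)).

Definition dmw_update eta A l : 'cV[R]_m :=
  \col_a (expR (- eta * l a 0) * A a 0).

End bregman.

Section oracle.
Context {R : realType} {m d : nat}.
Variables (A : 'M[R]_(m, d)) (b : 'cV[R]_m) (K : set 'cV[R]_d) (rho : R).

(* Comparing with every x in K expresses "at most the minimum plus alpha"
   without requiring the minimum to be attained. `| _ | is the sup norm. *)
Definition oracle_success (alpha : R) (y : 'cV[R]_m) (x : 'cV[R]_d) :=
  [/\ K x,
      forall z, K z ->
        \sum_i y i 0 * (A *m x) i 0 <= \sum_i y i 0 * (A *m z) i 0 + alpha &
      `| A *m x - b | <= rho].

(* A randomized procedure is a measurable function of its input and of a random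
   seed of law mu. The second clause, which makes the success probability
   meaningful, follows from the first one when K is a Borel set. *)
Definition bounded_oracle (alpha beta : R) dS (Seed : measurableType dS)
    (mu : probability Seed R) (O : 'cV[R]_m -> Seed -> 'cV[R]_d) :=
  [/\ measurable_fun [set: 'cV[R]_m * Seed] (fun p => O p.1 p.2),
      measurable [set p : 'cV[R]_m * Seed |
        is_distr p.1 /\ oracle_success alpha p.1 (O p.1 p.2)] &
      forall y, is_distr y ->
        ((1 - beta)%:E <= mu [set w | oracle_success alpha y (O y w)])%E].

End oracle.

(* The seeds xi 0, ..., xi (T - 1) are independent with common law mu, i.e.
   their joint law is the product measure. *)
Definition iid_seeds {R : realType} dS (Seed : measurableType dS)
    (mu : probability Seed R) dO (Omega : measurableType dO)
    (P : probability Omega R) (T : nat) (xi : nat -> {mfun Omega >-> Seed}) :=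
  forall B : nat -> set Seed, (forall t, measurable (B t)) ->
    P [set w | forall t, (t < T)%N -> B t (xi t w)] =
    (\prod_(t < T) mu (B t))%E.

Section dense_mw_lp.
Context {R : realType} {m d : nat}.

(* The number of rounds is rounded up to an integer; the maximum with 1 only
   matters when m = 1, where log m = 0. *)
Definition lp_rounds (rho alpha : R) : nat :=
  maxn 1 `|Num.ceil (36 * rho ^+ 2 * ln m%:R / alpha ^+ 2)|%N.

Definition lp_rate (rho alpha : R) : R :=
  Num.sqrt (ln m%:R / (lp_rounds rho alpha)%:R).

Variables (A : 'M[R]_(m, d)) (b : 'cV[R]_m) (rho alpha : R) (s : nat).

Definition lp_loss (x : 'cV[R]_d) : 'cV[R]_m :=
  \col_i ((2 * rho)^-1 * (b i 0 - (A *m x) i 0) + 2^-1).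

Context {Seed : Type}.
Variables (O : 'cV[R]_m -> Seed -> 'cV[R]_d) (w : nat -> Seed).

(* The pair of the unprojected measure and of the distribution given to the
   oracle at round t, rounds being numbered from 0. *)
Fixpoint lp_state (t : nat) : 'cV[R]_m * 'cV[R]_m :=
  if t is t'.+1 then
    let: (M, y) := lp_state t' in
    let M' := dmw_update (lp_rate rho alpha) M (lp_loss (O y (w t'))) in
    (M', bregman_proj s M')
  else (uniform_distr, uniform_distr).

Definition lp_point (t : nat) : 'cV[R]_d := O (lp_state t).2 (w t).

Definition dense_mw_lp : 'cV[R]_d :=
  (lp_rounds rho alpha)%:R^-1 *: \sum_(t < lp_rounds rho alpha) lp_point t.

End dense_mw_lp.

Arguments lp_rounds {R} m rho alpha.
Arguments lp_rate {R} m rho alpha.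

(* Main.v *)
(* Each projected distribution y^t minimizes KL(. || A^t) over the 1/s-dense
   distributions, and the potential Phi_t = KL(y^t || A^t) grows at round t by
   at least eta <y^t, l^t> - eta^2: the Pythagorean inequality for the
   projection leaves KL(y^{t+1} || y^t), which Gibbs' inequality trades against
   the loss. Comparing y^{T+1} with the uniform distribution on a set S of at
   least s constraints bounds Phi_{T+1} above by log m + eta <1_S / |S|, sum l^t>.
   If all oracle calls succeed, <y^t, l^t> >= 1/2 - alpha / (6 rho), whereas the
   mean loss of a constraint violated by more than alpha is below
   1/2 - alpha / (2 rho); so fewer than s constraints are violated.
   The distribution y^t is a measurable function of the first t - 1 seeds, so
   by Fubini the t-th call fails with probability at most beta / T, and a union
   bound over the T rounds concludes. *)
From HB Require Import structures.
Require Import Defs.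
From mathcomp Require Import ring lra measurable_realfun.

Set Implicit Arguments.
Unset Strict Implicit.
Unset Printing Implicit Defensive.

Local Open Scope classical_set_scope.
Local Open Scope ring_scope.

(** * Elementary bounds on [expR] and [ln] *)

(** As [expR z >= 1 + z], it suffices that [(1 - z + z ^+ 2) * (1 + z) = 1 + z ^+ 3 >= 1]. *)
Lemma expRN_le_quadratic (R : realType) (z : R) :
  0 <= z -> expR (- z) <= 1 - z + z ^+ 2.
Proof.
move=> z0; rewrite expRN -[leLHS]mul1r ler_pdivrMr ?expR_gt0//.
have q0 : 0 <= 1 - z + z ^+ 2 by nra.
apply: le_trans (ler_wpM2l q0 (expR_ge1Dx z)).
have : 0 <= z ^+ 3 by rewrite exprn_ge0.
by lra.
Qed.

Lemma ln_le_subr1 (R : realType) (u : R) : 0 < u -> ln u <= u - 1.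
Proof.
by move=> u0; have := @le_ln1Dx R (u - 1); rewrite subrKC; apply; lra.
Qed.

(** * Bregman projection and the growth of the potential in one round *)

Section dense_pair.
Context {R : realType} {m : nat}.
Implicit Types (M y B l : 'cV[R]_m) (s : nat) (eta : R).

(** For distributions this is KL(B || M) - KL(B || y); at [B = y] it is the potential KL(y || M). *)
Definition entropy_gap B M y : R := \sum_a B a 0 * (ln (y a 0) - ln (M a 0)).

(** The last clause is the Pythagorean inequality, i.e. the first-order optimality of [y] as the KL
    projection of [M]. *)
Definition dense_pair s M y :=
  [/\ forall a, 0 < M a 0, forall a, 0 < y a 0 <= s%:R^-1, \sum_a y a 0 = 1 &
      forall B, (forall a, B a 0 <= s%:R^-1) -> \sum_a B a 0 = 1 ->
        entropy_gap y M y <= entropy_gap B M y].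

Lemma dense_pair_distr s M y : dense_pair s M y -> is_distr y.
Proof. by case=> _ y0 y1 _; split=> // a; case/andP: (y0 a) => /ltW. Qed.

Lemma dense_pair_uniform s : (0 < s)%N -> (s <= m)%N ->
  dense_pair s (uniform_distr : 'cV[R]_m) uniform_distr.
Proof.
move=> s0 sm; have m0 : (0 < m)%N by exact: leq_trans sm.
split=> [a|a||B _ _]; rewrite /entropy_gap.
- by rewrite mxE invr_gt0 ltr0n.
- by rewrite mxE invr_gt0 ltr0n m0/= lef_pV2 ?posrE ?ltr0n// ler_nat.
- under eq_bigr do rewrite mxE.
  by rewrite sumr_const card_ord -[LHS]mulr_natl mulfV// pnatr_eq0 -lt0n.
- by rewrite !big1// => a _; rewrite subrr mulr0.
Qed.

(** Intermediate value theorem: the sum is 0 at [c = 0], and it is [m] at the sum [C] of the inverse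
    entries, where every term is capped. *)
Lemma bregman_scaleP s M : (s <= m)%N -> (forall a, 0 < M a 0) ->
  0 <= bregman_scale s M /\
  \sum_a Num.min 1 (bregman_scale s M * M a 0) = s%:R.
Proof.
move=> sm M0.
suff [c c0 cs] : exists2 c, 0 <= c & \sum_a Num.min 1 (c * M a 0) = s%:R.
  apply: (@xgetPex _ 0 [set c | 0 <= c /\
    \sum_a Num.min 1 (c * M a 0) = s%:R]).
  by exists c.
pose f c := \sum_a Num.min 1 (c * M a 0).
pose C := \sum_a (M a 0)^-1.
have C0 : 0 <= C by apply: sumr_ge0 => a _; rewrite invr_ge0 ltW.
have fC : f C = m%:R.
  rewrite /f (eq_bigr (fun=> 1)); first by rewrite sumr_const card_ord.
  move=> a _; apply/min_idPl; rewrite -ler_pdivrMr// mul1r /C (bigD1 a)//=.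
  by rewrite lerDl sumr_ge0// => i _; rewrite invr_ge0 ltW.
have f0 : f 0 = 0.
  by rewrite /f big1// => a _; rewrite mul0r; apply/min_idPr.
have cf : continuous f.
  apply: continuous_big => [|a _ x]; first exact: add_continuous.
  apply: (@continuous_min R R (fun=> 1) (fun c => c * M a 0)).
    exact: cvg_cst.
  by apply: cvgMl; exact: cvg_id.
have [||c cI fc] := @IVT _ f 0 C s%:R C0.
- exact: continuous_subspaceT.
- by rewrite f0 fC min_l ?max_r ?ler0n//= ler_nat.
- by exists c => //; move: cI; rewrite in_itv/= => /andP[].
Qed.

Lemma bregman_scale_gt0 s M : (0 < s)%N -> (s <= m)%N ->
  (forall a, 0 < M a 0) -> 0 < bregman_scale s M.
Proof.
move=> s0 sm M0; have [c0 cs] := bregman_scaleP sm M0.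
rewrite lt_neqAle c0 andbT; apply/eqP => c00; move: cs; rewrite -c00 big1.
  by move/esym/eqP; rewrite pnatr_eq0; case: s s0 {sm c0 c00}.
by move=> a _; rewrite mul0r; apply/min_idPr.
Qed.

(** Complementary slackness: the log-ratio of projection to [M] equals the multiplier at uncapped
    entries; at capped ones it is smaller, while [B] is at most the cap. *)
Lemma dense_pair_bregman_proj s M : (0 < s)%N -> (s <= m)%N ->
  (forall a, 0 < M a 0) -> dense_pair s M (bregman_proj s M).
Proof.
move=> s0 sm M0; have [_ cs] := bregman_scaleP sm M0.
have c0 := bregman_scale_gt0 s0 sm M0; set c := bregman_scale s M in cs c0.
have sV0 : 0 < s%:R^-1 :> R by rewrite invr_gt0 ltr0n.
have y1 : \sum_a bregman_proj s M a 0 = 1.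
  under eq_bigr do rewrite mxE.
  by rewrite -mulr_sumr cs mulVf// gt_eqF// ltr0n.
split=> // [a|B Bs B1].
  rewrite mxE mulr_gt0//=; last by rewrite lt_min ltr01 mulr_gt0.
  by rewrite ger_pMr// ge_min lexx.
(* [k] is the Lagrange multiplier of the constraint [sum y = 1]. *)
pose k := ln (s%:R^-1 * c).
rewrite -subr_ge0 /entropy_gap -sumrB.
(* [B] and the projection have the same mass, so subtracting the constant [k] does not change the
   sum. *)
rewrite (_ : \sum_a _ = \sum_a (B a 0 - bregman_proj s M a 0) *
  (ln (bregman_proj s M a 0) - ln (M a 0) - k)); last first.
  apply/eqP; rewrite -subr_eq0 -sumrB.
  rewrite (eq_bigr (fun a => (B a 0 - bregman_proj s M a 0) * k)).
    2: by move=> a _; ring.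
  by rewrite -mulr_suml sumrB B1 y1 subrr mul0r.
apply: sumr_ge0 => a _.
rewrite /k lnM ?posrE// mxE -/c.
have [cM|cM] := leP (c * M a 0) 1.
  rewrite !lnM ?posrE ?mulr_gt0// [X in _ * X](_ : _ = 0) ?mulr0//.
  by ring.
rewrite mulr1; have Ba := Bs a.
have : 0 < ln c + ln (M a 0) by rewrite -lnM ?posrE// ln_gt0.
by nra.
Qed.

Lemma dense_pair_step s M y M' y' l eta : 0 <= eta ->
  (forall a, 0 <= l a 0 <= 1) ->
  dense_pair s M y -> dense_pair s M' y' -> M' = dmw_update eta M l ->
  entropy_gap y M y + eta * \sum_a y a 0 * l a 0 - eta ^+ 2
    <= entropy_gap y' M' y'.
Proof.
move=> eta0 l01 [M0 y0 y1 yP] [_ y'0 y'1 _] ->.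
(* Optimality of the old projection is tested at the new one. *)
have yP' := yP y' (fun a => (andP (y'0 a)).2) y'1.
(* The right-hand side is KL of [y'] relative to the unnormalized measure [y * expR (- eta * l)];
   Gibbs' inequality bounds it below by the missing mass. *)
suff : 1 - \sum_a y a 0 * expR (- eta * l a 0) <=
    entropy_gap y' (dmw_update eta M l) y' - entropy_gap y' M y.
  have : \sum_a y a 0 * expR (- eta * l a 0) <=
      1 - eta * (\sum_a y a 0 * l a 0) + eta ^+ 2.
    (* The constants 1 and [eta ^+ 2] are written as averages over [y], to compare term by term. *)
    rewrite mulr_sumr -{1}y1 -sumrB -[X in _ + X]mul1r -[X in X * _]y1.
    rewrite mulr_suml -big_split/=; apply: ler_sum => a _.
    have /andP[l0 l1] := l01 a; have /andP[ya _] := y0 a.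
    rewrite mulNr (le_trans (ler_wpM2l (ltW ya) (expRN_le_quadratic _)))//.
      by rewrite mulr_ge0.
    have : eta ^+ 2 * l a 0 ^+ 2 <= eta ^+ 2.
      by rewrite ler_piMr ?sqr_ge0// expr_le1.
    by nra.
  by lra.
rewrite -y'1 -!sumrB; apply: ler_sum => a _; rewrite mxE.
have /andP[ya _] := y0 a; have /andP[y'a _] := y'0 a.
rewrite lnM ?posrE ?expR_gt0// expRK.
(* Gibbs' inequality termwise: [ln u <= u - 1] at this ratio, weighted by [y' a 0]. *)
have u0 : 0 < y a 0 * expR (- eta * l a 0) / y' a 0.
  by rewrite divr_gt0// mulr_gt0// expR_gt0.
have := ler_wpM2l (ltW y'a) (ln_le_subr1 u0).
rewrite ln_div ?posrE ?mulr_gt0 ?expR_gt0// lnM ?posrE ?expR_gt0// expRK.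
rewrite [X in _ <= X -> _]mulrBr mulr1 mulrCA divff ?gt_eqF// mulr1.
by lra.
Qed.

End dense_pair.

(** * Regret of dense multiplicative weights *)

Section regret.
Context {R : realType} {m : nat}.
Variables (s T : nat) (eta : R) (M y l : nat -> 'cV[R]_m).
Hypotheses (s_gt0 : (0 < s)%N) (s_le_m : (s <= m)%N) (eta_ge0 : 0 <= eta).
Hypotheses (M0 : M 0 = uniform_distr) (y0 : y 0 = uniform_distr).
Hypothesis MS : forall t, M t.+1 = dmw_update eta (M t) (l t).
Hypothesis My : forall t, dense_pair s (M t) (y t).
Hypothesis l01 : forall t, (t < T)%N -> forall a, 0 <= l t a 0 <= 1.

Let m_gt0 : (0 < m)%N. Proof. exact: leq_trans s_le_m. Qed.

Lemma entropy_gap_ge n : (n <= T)%N ->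
  eta * \sum_(t < n) (\sum_a y t a 0 * l t a 0) - n%:R * eta ^+ 2 <=
    entropy_gap (y n) (M n) (y n).
Proof.
elim: n => [_|n IH nT].
  rewrite big_ord0 mulr0 mul0r subrr M0 y0 /entropy_gap big1// => a _.
  by rewrite subrr mulr0.
have := dense_pair_step eta_ge0 (l01 nT) (My n) (My n.+1) (MS n).
have := IH (ltnW nT); rewrite big_ord_recr/= -[n.+1%:R]natr1.
by lra.
Qed.

Lemma ln_dmw_weight n a :
  ln (M n a 0) = - ln m%:R - eta * \sum_(t < n) l t a 0.
Proof.
elim: n => [|n IH].
  by rewrite big_ord0 mulr0 subr0 M0 mxE lnV// posrE ltr0n.
have [Mn _ _ _] := My n.
rewrite MS mxE lnM ?posrE ?expR_gt0// expRK IH big_ord_recr/=.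
by ring.
Qed.

Lemma dmw_regret (S : {set 'I_m}) : (s <= #|S|)%N ->
  eta * \sum_(t < T) (\sum_a y t a 0 * l t a 0) <=
    ln m%:R + eta * (#|S|%:R^-1 * \sum_(a in S) \sum_(t < T) l t a 0)
    + T%:R * eta ^+ 2.
Proof.
move=> sS; have S0 : (0 < #|S|)%N by exact: leq_trans sS.
have SV0 : 0 < #|S|%:R^-1 :> R by rewrite invr_gt0 ltr0n.
(* The comparator is uniform on [S]; it is 1/s-dense because [S] has at least [s] elements. *)
pose B : 'cV[R]_m := \col_a if a \in S then #|S|%:R^-1 else 0.
have Bs a : B a 0 <= s%:R^-1.
  rewrite mxE; case: ifP => _; last by rewrite invr_ge0.
  by rewrite lef_pV2 ?posrE ?ltr0n// ler_nat.
have BE (F : 'I_m -> R) :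
    \sum_a B a 0 * F a = #|S|%:R^-1 * \sum_(a in S) F a.
  rewrite mulr_sumr [RHS]big_mkcond/=; apply: eq_bigr => a _; rewrite mxE.
  by case: ifP; rewrite ?mul0r.
have B1 : \sum_a B a 0 = 1.
  under eq_bigr do rewrite -[B _ _]mulr1.
  by rewrite BE sumr_const mulVf// pnatr_eq0 -lt0n.
have [_ yT _ yP] := My T.
have := entropy_gap_ge (leqnn T); have := yP B Bs B1.
suff : entropy_gap B (M T) (y T) <=
    ln m%:R + eta * (#|S|%:R^-1 * \sum_(a in S) \sum_(t < T) l t a 0) by lra.
have -> : ln m%:R +
      eta * (#|S|%:R^-1 * \sum_(a in S) \sum_(t < T) l t a 0) =
    #|S|%:R^-1 * \sum_(a in S) (ln m%:R + eta * \sum_(t < T) l t a 0).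
  rewrite big_split/= sumr_const mulrDr -[ln _ *+ _]mulr_natl mulKf.
    by rewrite -mulr_sumr mulrCA.
  by rewrite pnatr_eq0 -lt0n.
rewrite /entropy_gap BE ler_pM2l//; apply: ler_sum => a _.
rewrite ln_dmw_weight; have /andP[ya ys] := yT a.
(* The entropy term of the comparison has a favourable sign, as [y T a 0 <= s%:R^-1 <= 1]. *)
suff : ln (y T a 0) <= 0 by lra.
by rewrite ln_le0// (le_trans ys)// invf_le1 ?ltr0n// ler1n.
Qed.

(** This rate balances the two error terms: [T%:R * eta ^+ 2 = ln m%:R], so division by [eta] leaves
    twice [T%:R * eta]. *)
Lemma dmw_average_regret (S : {set 'I_m}) : (s <= #|S|)%N -> (0 < T)%N ->
  eta = Num.sqrt (ln m%:R / T%:R) ->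
  \sum_(t < T) (\sum_a y t a 0 * l t a 0) <=
    #|S|%:R^-1 * (\sum_(a in S) \sum_(t < T) l t a 0) + 2 * T%:R * eta.
Proof.
move=> sS T0 etaE; have lnm0 : 0 <= ln m%:R :> R by rewrite ln_ge0// ler1n.
have eta2 : T%:R * eta ^+ 2 = ln m%:R.
  by rewrite etaE sqr_sqrtr ?divr_ge0// mulrC divfK// pnatr_eq0 -lt0n.
have [eta0|eta0] := eqVneq eta 0; last first.
  have {eta0} eta0 : 0 < eta by rewrite lt_neqAle eq_sym eta0.
  rewrite -(ler_pM2l eta0); have := dmw_regret sS; rewrite -eta2; by lra.
(* A zero rate forbids the division but forces a single constraint, for which both sides are the
   same total loss. *)
have m1 : m = 1%N.
  move: eta2; rewrite eta0 expr0n mulr0 => /esym/eqP.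
  by rewrite ln_eq0 ?ltr0n// pnatr_eq1 => /eqP.
have a0 (a a' : 'I_m) : a' = a.
  by apply/val_inj; case: a a' => [[|n] +] [[|n'] +]//=; rewrite m1.
have S0 : (0 < #|S|)%N by exact: leq_trans sS.
case/card_gt0P: (S0) => a aS.
rewrite eta0 mulr0 addr0 [X in _ * X](eq_bigr (fun=> \sum_(t < T) l t a 0)); last first.
  by move=> a' _; rewrite (a0 a a').
rewrite sumr_const -[X in _ * X]mulr_natl mulKf.
  2: by rewrite pnatr_eq0 -lt0n.
apply: ler_sum => t _; have [_ _ yt _] := My t.
rewrite (eq_bigr (fun a' => y t a' 0 * l t a 0)).
  by rewrite -mulr_suml yt mul1r.
by move=> a' _; rewrite (a0 a a').
Qed.
End regret.

(** * Means of points in a convex set *)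

Lemma convex_set_mean (R : realType) (E : lmodType R)
    (K : set (convex_lmodType E)) (x : nat -> E) (n : nat) :
  convex_set K -> (0 < n)%N -> (forall t, (t < n)%N -> K (x t)) ->
  K (n%:R^-1 *: \sum_(t < n) x t).
Proof.
move=> cK; case: n => // n _; elim: n => [|n IH] Kx.
  by rewrite big_ord1 invr1 scale1r; exact: Kx.
(* The new mean combines the mean of the first [n.+1] points, with this weight, and the last
   point. *)
have l0 : 0 <= n.+1%:R / n.+2%:R :> R by rewrite divr_ge0.
have l1 : n.+1%:R / n.+2%:R <= 1 :> R.
  by rewrite ler_pdivrMr ?ltr0n// mul1r ler_nat.
have := cK (n.+1%:R^-1 *: \sum_(t < n.+1) x t) (x n.+1) (Itv01 l0 l1).
rewrite !inE => /(_ (IH _) (Kx _ _)); rewrite ltnSn => /(_ _ isT) Kc.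
have {Kc} := Kc (fun t tn => Kx t (ltnW tn)); congr K.
rewrite /conv/= scalerA [in RHS]big_ord_recr/= scalerDr.
congr (_ *: _ + _ *: _).
  by rewrite mulrC mulrA mulVf ?mul1r// pnatr_eq0.
have n2 : n.+2%:R != 0 :> R by rewrite pnatr_eq0.
by rewrite /unstable.onem -{1}(divff n2) -mulrBl -natrB// subSnn mul1r.
Qed.

(** * Deterministic correctness of a run whose oracle calls all succeed *)

Section lp_run.
Context {R : realType} {m d : nat}.
Variables (A : 'M[R]_(m, d)) (b : 'cV[R]_m) (K : set 'cV[R]_d).
Variables (rho alpha : R) (s : nat).
Hypotheses (s_gt0 : (0 < s)%N) (s_le_m : (s <= m)%N).

Lemma le_mx_norm_entry (M : 'cV[R]_m) i : `|M i 0| <= `|M|.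
Proof.
by rewrite [leRHS]/Num.Def.normr/= mx_normrE; apply/bigmax_geP; right; exists (i, 0).
Qed.

Lemma lp_loss_bounds (x : 'cV[R]_d) i : 0 < rho -> `|A *m x - b| <= rho ->
  0 <= lp_loss A b rho x i 0 <= 1.
Proof.
move=> rho0 xrho; have := le_trans (le_mx_norm_entry _ i) xrho.
rewrite !mxE ler_norml => /andP[Al Ar].
set a := \sum_j _ in Al Ar *.
have -> : (2 * rho)^-1 * (b i 0 - a) + 2^-1 = (rho + (b i 0 - a)) / (2 * rho).
  by field; rewrite gt_eqF.
rewrite divr_ge0 ?mulr_ge0 ?(ltW rho0)//=; last by lra.
by rewrite ler_pdivrMr ?mulr_gt0//; lra.
Qed.

Lemma lp_rounds_gt0 : (0 < lp_rounds m rho alpha)%N.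
Proof. by rewrite leq_max. Qed.

Lemma lp_rounds_ge :
  36 * rho ^+ 2 * ln m%:R / alpha ^+ 2 <= (lp_rounds m rho alpha)%:R.
Proof.
set q := leLHS; have m0 : (0 < m)%N by exact: leq_trans s_le_m.
(* Nonnegativity makes the ceiling equal to its absolute value, used in [lp_rounds]. *)
have q0 : 0 <= q.
  have : 0 <= ln m%:R :> R by rewrite ln_ge0// ler1n.
  move=> lnm0; rewrite /q divr_ge0// ?sqr_ge0// mulr_ge0// mulr_ge0//.
  exact: sqr_ge0.
apply: (@le_trans _ _ `|Num.ceil q|%N%:R); last by rewrite ler_nat leq_maxr.
by rewrite natr_absz ger0_norm ?ceil_ge// -(ceil0 R) le_ceil.
Qed.

(** The factor 36 in the number of rounds is the square of the 6 here. *)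
Lemma lp_rate_le : 0 < rho -> 0 < alpha ->
  lp_rate m rho alpha <= alpha / (6 * rho).
Proof.
move=> rho0 alpha0; have m0 : (0 < m)%N by exact: leq_trans s_le_m.
have lnm0 : 0 <= ln m%:R :> R by rewrite ln_ge0// ler1n.
have r0 : 0 <= alpha / (6 * rho) by rewrite divr_ge0 ?mulr_ge0 ?ltW.
rewrite -[leRHS]ger0_norm// -sqrtr_sqr ler_wsqrtr//.
rewrite ler_pdivrMr ?ltr0n ?lp_rounds_gt0// expr_div_n -ler_pdivrMl; last first.
  by rewrite divr_gt0// exprn_gt0// mulr_gt0.
apply: le_trans lp_rounds_ge; rewrite le_eqVlt; apply/orP; left; apply/eqP.
by field; rewrite !gt_eqF.
Qed.

Context {Seed : Type}.
Variables (O : 'cV[R]_m -> Seed -> 'cV[R]_d) (w : nat -> Seed).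

Local Notation state := (lp_state A b rho alpha s O w).
Local Notation point := (lp_point A b rho alpha s O w).

Lemma lp_stateS t : state t.+1 =
  let M := dmw_update (lp_rate m rho alpha) (state t).1
    (lp_loss A b rho (point t)) in (M, bregman_proj s M).
Proof. by rewrite /lp_point/=; case: lp_state. Qed.

Lemma dense_pair_lp_state t : dense_pair s (state t).1 (state t).2.
Proof.
elim: t => [|t [M0 _ _ _]]; first exact: dense_pair_uniform.
rewrite lp_stateS; apply: dense_pair_bregman_proj => // a.
by rewrite mxE mulr_gt0// expR_gt0.
Qed.

Lemma lp_average_regret (S : {set 'I_m}) :
  0 < rho ->
  (forall t, (t < lp_rounds m rho alpha)%N -> `|A *m point t - b| <= rho) ->
  (s <= #|S|)%N ->
  \sum_(t < lp_rounds m rho alpha)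
      (\sum_a (state t).2 a 0 * lp_loss A b rho (point t) a 0) <=
    #|S|%:R^-1 * (\sum_(a in S) \sum_(t < lp_rounds m rho alpha)
      lp_loss A b rho (point t) a 0) +
    2 * (lp_rounds m rho alpha)%:R * lp_rate m rho alpha.
Proof.
move=> rho0 xrho sS.
apply: (@dmw_average_regret _ _ s _ _
  (fun t => (state t).1) (fun t => (state t).2)
  (fun t => lp_loss A b rho (point t))) => //.
- by rewrite sqrtr_ge0.
- by move=> t; rewrite lp_stateS.
- exact: dense_pair_lp_state.
- by move=> t /xrho xr a; exact: lp_loss_bounds.
- exact: lp_rounds_gt0.
Qed.

Lemma dense_mw_lp_correct : convex_set K -> 0 < alpha -> 0 < rho ->
  (exists2 x, K x & forall i, (A *m x) i 0 <= b i 0) ->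
  (forall t, (t < lp_rounds m rho alpha)%N ->
    oracle_success A b K rho (alpha / 3) (state t).2 (point t)) ->
  let xbar := dense_mw_lp A b rho alpha s O w in
  K xbar /\ exists S : {set 'I_m}, (#|S| < s)%N /\
    forall i, i \notin S -> (A *m xbar) i 0 <= b i 0 + alpha.
Proof.
move=> cK alpha0 rho0 [z Kz zb] succ xbar.
set T := lp_rounds m rho alpha in succ.
have T0 : 0 < T%:R :> R by rewrite ltr0n lp_rounds_gt0.
split.
  apply: (convex_set_mean (x := point)) => //; first exact: lp_rounds_gt0.
  by move=> t /succ[].
exists (finset (fun i => b i 0 + alpha < (A *m xbar) i 0)); split; last first.
  by move=> i; rewrite inE -leNgt.
rewrite ltnNge; apply/negP => sS; set S := finset _ in sS.
have S0 : (0 < #|S|)%N by exact: leq_trans sS.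
(* The oracle's point is compared with the feasible [z], whose [y]-weighted left-hand side is at
   most that of [b]. *)
have yl t : (t < T)%N -> 2^-1 - alpha / (6 * rho) <=
    \sum_a (state t).2 a 0 * lp_loss A b rho (point t) a 0.
  move=> tT; have [_ /(_ _ Kz) opt _] := succ _ tT.
  have [y0 y1] := dense_pair_distr (dense_pair_lp_state t).
  have yzb : \sum_i (state t).2 i 0 * (A *m z) i 0 <=
      \sum_i (state t).2 i 0 * b i 0.
    by apply: ler_sum => i _; rewrite ler_wpM2l.
  have -> : \sum_a (state t).2 a 0 * lp_loss A b rho (point t) a 0 =
      (2 * rho)^-1 * (\sum_i (state t).2 i 0 * b i 0 -
        \sum_i (state t).2 i 0 * (A *m point t) i 0) + 2^-1.
    rewrite [X in _ = _ + X](_ : _ = \sum_i (state t).2 i 0 * 2^-1).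
      rewrite -sumrB mulr_sumr -big_split/=.
      by apply: eq_bigr => a _; rewrite [lp_loss _ _ _ _ _ _]mxE; ring.
    by rewrite -mulr_suml y1 mul1r.
  have -> : alpha / (6 * rho) = (2 * rho)^-1 * (alpha / 3).
    by field; rewrite gt_eqF.
  have : 0 <= (2 * rho)^-1 by rewrite invr_ge0 mulr_ge0 ?ltW.
  by nra.
have Sl a : a \in S -> \sum_(t < T) lp_loss A b rho (point t) a 0 <
    T%:R * (2^-1 - alpha / (2 * rho)).
  rewrite inE => abar.
  (* The loss is affine in the point, so its average over the rounds is the loss of [xbar]. *)
  have -> : \sum_(t < T) lp_loss A b rho (point t) a 0 =
      T%:R * ((2 * rho)^-1 * (b a 0 - (A *m xbar) a 0) + 2^-1).
    rewrite /xbar /dense_mw_lp -/T -scalemxAr mulmx_sumr [in RHS]mxE summxE.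
    under eq_bigr do rewrite mxE.
    rewrite big_split/= -mulr_sumr sumrB !sumr_const card_ord.
    rewrite -[b a 0 *+ T]mulr_natl -[_ *+ T]mulr_natl; field.
    by rewrite !gt_eqF.
  rewrite ltr_pM2l// addrC ltrD2l mulrC -mulNr ltr_pM2r; last first.
    by rewrite invr_gt0 mulr_gt0.
  by lra.
have xrho t : (t < T)%N -> `|A *m point t - b| <= rho by case/succ.
have := lp_average_regret rho0 xrho sS.
rewrite -/T leNgt => /negP; apply.
apply: (@lt_le_trans _ _ (T%:R * (2^-1 - alpha / (6 * rho)))); last first.
  rewrite mulr_natl -[X in _ *+ X]card_ord -sumr_const; apply: ler_sum => t _.
  exact: yl.
apply: (@lt_le_trans _ _ (T%:R * (2^-1 - alpha / (2 * rho)) +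
    2 * T%:R * lp_rate m rho alpha)).
  rewrite ltrD2r ltr_pdivrMl ?ltr0n// [ltRHS]mulr_natl -sumr_const.
  (* One member of [S] makes the inequality between the sums strict. *)
  have /card_gt0P[a aS] := S0.
  rewrite (bigD1 a)//= [ltRHS](bigD1 a)//= ltr_leD ?Sl//.
  by apply: ler_sum => a' /andP[a'S _]; exact/ltW/Sl.
(* In units of [alpha / (6 * rho)], a violation gains 3, the regret costs 2 and the oracle 1: there
   is no slack, and the contradiction rests on the strictness of [Sl]. *)
have := lp_rate_le rho0 alpha0; rewrite -(ler_pM2l T0).
have -> : alpha / (2 * rho) = 3 * (alpha / (6 * rho)).
  by field; rewrite gt_eqF.
by lra.
Qed.

End lp_run.

(** * Measurability of the run as a function of the seeds *)

Section measurable_cV.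
Context {R : realType} {d : measure_display} {T : measurableType d} {n : nat}.

Lemma measurable_entry (i : 'I_n) :
  measurable_fun [set: 'cV[R]_n] (fun v : 'cV[R]_n => v i 0 : measurableTypeR R).
Proof.
move=> _ Y mY; rewrite setTI; apply: sub_sigma_algebra.
rewrite -bigcup_seq/=; exists i => /=; first by rewrite mem_index_enum.
by exists Y => //; rewrite setTI.
Qed.

Lemma measurable_fun_cV (f : T -> 'cV[R]_n) :
  (forall i, measurable_fun [set: T] (fun x => f x i 0 : measurableTypeR R)) ->
  measurable_fun [set: T] f.
Proof.
move=> mf; apply: measurability; first by [].
move=> _ [B + <-]; rewrite -bigcup_seq => -[i _] [C mC <-].
by rewrite !setTI; rewrite -[X in measurable X]setTI; exact: mf.
Qed.

Lemma measurable_fun_entry (f : T -> 'cV[R]_n) (i : 'I_n) :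
  measurable_fun [set: T] f ->
  measurable_fun [set: T] (fun x => f x i 0 : measurableTypeR R).
Proof. by move=> mf; exact: (measurableT_comp (measurable_entry i) mf). Qed.

End measurable_cV.

(* The right-hand side, divided by [M a 0], says that the sum defining the
   scale [c] is below [s] at [r / M a 0], i.e. [r / M a 0 < c]. It does not
   mention the chosen [c], hence gives the measurability of the projection. *)
Lemma lt_bregman_scale (R : realType) (m s : nat) (M : 'cV[R]_m) a r :
  (s <= m)%N -> (forall a, 0 < M a 0) -> 0 <= r < 1 ->
  (r < bregman_scale s M * M a 0) =
  (\sum_i Num.min (M a 0) (r * M i 0) < s%:R * M a 0).
Proof.
move=> sm M0 /andP[r0 r1]; have [_ cs] := bregman_scaleP sm M0.
set c := bregman_scale s M in cs *.
have -> : s%:R * M a 0 = \sum_i Num.min (M a 0) (c * M a 0 * M i 0).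
  rewrite -cs mulr_suml; apply: eq_bigr => i _.
  by rewrite minr_pMl ?(ltW (M0 a))// mul1r mulrAC.
apply/idP/idP => [rc|].
  (* The term at [a] grows strictly, since [r < 1] keeps it below the cap [M a 0]; the other terms
     are monotone. *)
  rewrite (bigD1 a)//= [ltRHS](bigD1 a)//= ltr_leD//.
    have rM : r * M a 0 < M a 0 by rewrite gtr_pMl.
    by rewrite lt_min gt_min !gt_min rM ltr_pM2r// rc !orbT.
  by apply: ler_sum => i _; rewrite le_min2// ler_pM2r// ltW.
apply: contraTT; rewrite -!leNgt => cr.
by apply: ler_sum => i _; rewrite le_min2// ler_pM2r.
Qed.

Section measurable_lp.
Context {R : realType} {d : measure_display} {T : measurableType d} {m : nat}.
Implicit Types (f : T -> 'cV[R]_m).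

Lemma measurable_bregman_proj s f : (s <= m)%N ->
  (forall x a, 0 < f x a 0) -> measurable_fun [set: T] f ->
  measurable_fun [set: T] (fun x => bregman_proj s (f x)).
Proof.
move=> sm f0 mf; apply: measurable_fun_cV => a.
under eq_fun do rewrite mxE.
apply: measurable_funM => //.
apply: (measurability _ (RGenOInfty.measurableE R)) => //.
move=> _ [_ [r ->] <-]; rewrite setTI.
(* The minimum lies between 0 and 1, so only levels [0 <= r < 1] give a nontrivial preimage. *)
have [r0|r0] := ltP r 0.
  rewrite (_ : _ @^-1` _ = setT)//; apply/seteqP; split=> // x _ /=.
  rewrite in_itv/= andbT (lt_le_trans r0)// le_min ler01 mulr_ge0//.
    by have [] := bregman_scaleP sm (f0 x).
  exact: ltW.
have [r1|r1] := leP 1 r.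
  rewrite (_ : _ @^-1` _ = set0)//; apply/seteqP; split=> // x /=.
  by rewrite in_itv/= andbT lt_min ltNge r1.
rewrite (_ : _ @^-1` _ = [set x |
    \sum_i Num.min (f x a 0) (r * f x i 0) < s%:R * f x a 0]); last first.
  apply/seteqP; split=> x /=; rewrite in_itv/= andbT lt_min r1/=;
    by rewrite lt_bregman_scale// r0.
have mlt : measurable_fun [set: T] (fun x =>
    \sum_i Num.min (f x a 0) (r * f x i 0) < s%:R * f x a 0).
  apply: measurable_fun_ltr.
    apply: measurable_sum => i; apply: measurable_minr.
      exact: measurable_fun_entry.
    by apply: measurable_funM => //; exact: measurable_fun_entry.
  by apply: measurable_funM => //; exact: measurable_fun_entry.
by have := mlt measurableT [set true] I; rewrite setTI.
Qed.

Context {n : nat} (A : 'M[R]_(m, n)) (b : 'cV[R]_m) (rho alpha : R) (s : nat).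
Context {dS : measure_display} {Seed : measurableType dS}.
Variables (O : 'cV[R]_m -> Seed -> 'cV[R]_n) (u : T -> nat -> Seed).
Hypotheses (s_gt0 : (0 < s)%N) (s_le_m : (s <= m)%N).
Hypothesis mO : measurable_fun [set: 'cV[R]_m * Seed] (fun p => O p.1 p.2).

Local Notation state t := (fun x => lp_state A b rho alpha s O (u x) t).
Local Notation point t := (fun x => lp_point A b rho alpha s O (u x) t).

Lemma measurable_lp_loss (g : T -> 'cV[R]_n) : measurable_fun [set: T] g ->
  measurable_fun [set: T] (fun x => lp_loss A b rho (g x)).
Proof.
move=> mg; apply: measurable_fun_cV => i; under eq_fun do rewrite mxE.
apply: measurable_funD => //; apply: measurable_funM => //.
apply: measurable_funB => //; under eq_fun do rewrite mxE.
apply: measurable_sum => j; apply: measurable_funM => //.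
exact: measurable_fun_entry.
Qed.

Lemma measurable_lp_point t :
  measurable_fun [set: T] (fun x => (state t x).2) ->
  measurable_fun [set: T] (u ^~ t) -> measurable_fun [set: T] (point t).
Proof.
by move=> my mu; exact: (measurableT_comp mO (measurable_fun_pair my mu)).
Qed.

(** Only seeds of index below [t] are assumed measurable, so that the domain may carry just the
    sigma-algebra of the past. *)
Lemma measurable_lp_state t :
  (forall i, (i < t)%N -> measurable_fun [set: T] (u ^~ i)) ->
  measurable_fun [set: T] (fun x => (state t x).1) /\
  measurable_fun [set: T] (fun x => (state t x).2).
Proof.
elim: t => [_|t IH mut]; first by split; exact: measurable_cst.
have [mM my] := IH (fun i it => mut i (ltnW it)).
have mp := measurable_lp_point my (mut t (ltnSn t)).
have mM' : measurable_fun [set: T] (fun x =>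
    dmw_update (lp_rate m rho alpha) (state t x).1
      (lp_loss A b rho (point t x))).
  apply: measurable_fun_cV => a; under eq_fun do rewrite mxE.
  apply: measurable_funM; last exact: measurable_fun_entry.
  apply: measurableT_comp => //; apply: measurable_funM => //.
  by apply: measurable_fun_entry; exact: measurable_lp_loss.
split; under eq_fun do rewrite lp_stateS/=; first exact: mM'.
apply: measurable_bregman_proj => // x a.
have [M0 _ _ _] := dense_pair_lp_state A b rho alpha s_gt0 s_le_m O (u x) t.
by rewrite mxE mulr_gt0// expR_gt0.
Qed.

End measurable_lp.

(** * Independence of each seed from the past, and the union bound *)

(** By independence the joint law is a product measure, so Fubini turns the probability into the
    integral of the [mu]-measures of the sections. *)
Lemma le_probability_section (R : realType) d d1 d2 (Omega : measurableType d)
    (T1 : measurableType d1) (T2 : measurableType d2)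
    (P : probability Omega R) (mu : probability T2 R)
    (X : {mfun Omega >-> T1}) (Y : {mfun Omega >-> T2})
    (S : set (T1 * T2)) (p : R) :
  (forall A B, measurable A -> measurable B ->
    P (X @^-1` A `&` Y @^-1` B) = (P (X @^-1` A) * mu B)%E) ->
  measurable S -> 0 <= p -> (forall w, (p%:E <= mu (xsection S (X w)))%E) ->
  (p%:E <= P [set w | S (X w, Y w)])%E.
Proof.
move=> XY mS p0 pS.
have mZ : measurable_fun [set: Omega] (fun w => (X w, Y w)).
  exact: measurable_fun_pair.
pose Z : {mfun Omega >-> (T1 * T2)%type} :=
  HB.pack (fun w => (X w, Y w)) (isMeasurableFun.Build _ _ _ _ _ mZ).
rewrite -[leRHS]/(distribution P Z S).
have <- : (distribution P X \x mu)%E S = distribution P Z S.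
  exact: product_measure_unique.
have msec := measurable_fun_xsection mu mS.
rewrite /product_measure1 ge0_integral_pushforward//= ?preimage_setT.
rewrite -[leLHS]mule1 -(probability_setT P) -integral_cst//.
apply: ge0_le_integral => //=; exact: (measurableT_comp msec).
Qed.

Section history.
Context {R : realType} {dS dO : measure_display} {Seed : measurableType dS}
  {Omega : measurableType dO}.
Variables (mu : probability Seed R) (P : probability Omega R).
Variables (xi : nat -> {mfun Omega >-> Seed}).

(** A pi-system generating the sigma-algebra of the first [t] seeds. *)
Definition history (t : nat) : set (set Omega) :=
  [set H | exists2 B : nat -> set Seed, forall i, measurable (B i) &
    H = \bigcap_(i < t) (xi i @^-1` B i)].

Lemma measurable_seed_preimage t (B : set Seed) :
  measurable B -> measurable (xi t @^-1` B).
Proof. by move=> mB; rewrite -[X in measurable X]setTI; exact: measurable_funPT. Qed.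

Lemma history_measurable t : history t `<=` measurable.
Proof.
move=> _ [B mB ->]; apply: fin_bigcap_measurable; first exact: finite_II.
by move=> i _; exact: measurable_seed_preimage.
Qed.

Lemma measurable_id_history t : measurable_fun [set: Omega]
  (fun w => w : g_sigma_algebraType (history t)).
Proof.
move=> _ A; rewrite setTI; apply: smallest_sub; last exact: history_measurable.
exact: sigma_algebra_measurable.
Qed.

Lemma historyT t : history t setT.
Proof. by exists (fun=> setT) => //; rewrite bigcapT//. Qed.

Lemma history_setI_closed t : setI_closed (history t).
Proof.
move=> _ _ [B mB ->] [C mC ->]; exists (fun i => B i `&` C i).
  by move=> i; exact: measurableI.
by rewrite -bigcapI; apply: eq_bigcapr => i _; rewrite preimage_setI.
Qed.

Lemma measurable_seed_history t i : (i < t)%N ->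
  measurable_fun [set: g_sigma_algebraType (history t)] (xi i).
Proof.
move=> it _ B mB; rewrite setTI; apply: sub_sigma_algebra.
exists (fun j => if j == i then B else setT); first by move=> j; case: ifP.
apply/seteqP; split=> [w Bw j _|w /(_ i it)] /=; last by rewrite eqxx.
by case: eqP => // ->.
Qed.

Lemma history_indep_cylinder T t (B : nat -> set Seed) (C : set Seed) :
  iid_seeds mu P T xi -> (t < T)%N -> (forall i, measurable (B i)) ->
  measurable C ->
  P ((\bigcap_(i < t) (xi i @^-1` B i)) `&` xi t @^-1` C) =
  (P (\bigcap_(i < t) (xi i @^-1` B i)) * mu C)%E.
Proof.
move=> iid tT mB mC.
(* Padding by [setT] after round [t] brings both events, with [D := C] and [D := setT], under
   [iid_seeds]; the two products differ only in factor [t]. *)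
pose F (D : set Seed) i := if (i < t)%N then B i else if i == t then D else setT.
have mF D : measurable D -> forall i, measurable (F D i).
  by move=> mD i; rewrite /F; case: ifP => // _; case: ifP.
have FE D : (\bigcap_(i < t) (xi i @^-1` B i)) `&` xi t @^-1` D =
    [set w | forall i, (i < T)%N -> F D i (xi i w)].
  apply/seteqP; split=> [w [Bw Dw] i iT|w Fw].
    rewrite /F; case: ifPn => [it|_]; first exact: Bw.
    by case: eqP => // ->.
  split=> [i it|]; first by have := Fw i (ltn_trans it tT); rewrite /F it.
  by have := Fw t tT; rewrite /F ltnn eqxx.
rewrite -[X in (P X * _)%E]setIT -(@preimage_setT _ _ (xi t)) !FE.
rewrite !iid; try exact: mF.
rewrite (bigD1 (Ordinal tT))//= [in RHS](bigD1 (Ordinal tT))//=.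
rewrite /F ltnn eqxx probability_setT mul1e muleC; congr (_ * _)%E.
apply: eq_bigr => i it; congr (mu _).
by rewrite -(inj_eq val_inj)/= in it; rewrite (negbTE it).
Qed.

(** For fixed [C], both sides are finite measures in [H] that agree on the cylinders, hence on the
    sigma-algebra they generate. *)
Lemma history_indep T t (H : set Omega) (C : set Seed) :
  iid_seeds mu P T xi -> (t < T)%N -> <<s history t >> H -> measurable C ->
  P (H `&` xi t @^-1` C) = (P H * mu C)%E.
Proof.
move=> iid tT sH mC.
have mid := @measurable_id_history t.
have mX : measurable (xi t @^-1` C) by exact: measurable_seed_preimage.
have C0 : 0 <= fine (mu C) by rewrite fine_ge0.
have CE : (NngNum C0)%:num%:E = mu C by rewrite /= fineK// fin_num_measure.
rewrite -CE muleC.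
pose id' : {mfun Omega >-> g_sigma_algebraType (history t)} :=
  HB.pack (fun w : Omega => w : g_sigma_algebraType (history t))
    (isMeasurableFun.Build _ _ _ _ _ mid).
have := @measure_unique _ R (g_sigma_algebraType (history t)) (history t) (fun=> setT) erefl
  (@history_setI_closed t) (fun=> @historyT t) _
  (pushforward (mrestr P mX) id') (mscale (NngNum C0) (distribution P id')) _ _ _ sH.
apply.
- by apply/seteqP; split=> // w _; exists 0.
- move=> _ [B mB ->].
  transitivity
    ((NngNum C0)%:num%:E * P (\bigcap_(i < t) (xi i @^-1` B i)))%E => //.
  by rewrite CE muleC; exact: (history_indep_cylinder iid tT mB mC).
- move=> _; suff : (P (setT `&` xi t @^-1` C) < +oo)%E by [].
  by rewrite setTI (le_lt_trans (probability_le1 P mX))// ltry.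
Qed.
End history.

Lemma probability_bigcap_ge (R : realType) d (Omega : measurableType d)
    (P : probability Omega R) (n : nat) (F : nat -> set Omega) (e : R) :
  (forall i, (i < n)%N -> measurable (F i)) ->
  (forall i, (i < n)%N -> ((1 - e)%:E <= P (F i))%E) ->
  ((1 - n%:R * e)%:E <= P (\bigcap_(i < n) F i))%E.
Proof.
move=> mF PF.
have mI : measurable (\bigcap_(i < n) F i).
  by apply: fin_bigcap_measurable => //; exact: finite_II.
have -> : P (\bigcap_(i < n) F i) = (1 - P (~` (\bigcap_(i < n) F i)))%E.
  by rewrite -probability_setC ?setCK//; exact: measurableC.
rewrite EFinB leeB//.
(* The failure events, extended by the empty set to be measurable at every index. *)
pose G i := if (i < n)%N then ~` F i else set0.
have mG i : measurable (G i).
  by rewrite /G; case: ifPn => // /mF /measurableC.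
apply: (@le_trans _ _ (\sum_(i < n) P (G i))%E).
  apply: content_subadditive => //; first exact: measurableC.
  rewrite setC_bigcap -bigcup_mkord => w [i iT Fw].
  by exists i => //; rewrite /G ifT.
apply: (@le_trans _ _ (\sum_(i < n) e%:E)%E).
  apply: lee_sum => i _; rewrite /G ltn_ord probability_setC; last exact: mF.
  have := PF i (ltn_ord i).
  rewrite -(fineK (fin_num_measure P _ (mF i (ltn_ord i)))).
  by rewrite -EFinB !lee_fin; lra.
by rewrite sumEFin lee_fin sumr_const card_ord mulr_natl.
Qed.

Section success.
Context {R : realType} {m d : nat}.
Variables (A : 'M[R]_(m, d)) (b : 'cV[R]_m) (K : set 'cV[R]_d).
Variables (rho alpha delta eps : R) (s T : nat).
Context {dS : measure_display} {Seed : measurableType dS}.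
Variables (mu : probability Seed R) (O : 'cV[R]_m -> Seed -> 'cV[R]_d).
Context {dO : measure_display} {Omega : measurableType dO}.
Variables (P : probability Omega R) (xi : nat -> {mfun Omega >-> Seed}).
Hypotheses (s_gt0 : (0 < s)%N) (s_le_m : (s <= m)%N).
Hypothesis oracle : bounded_oracle A b K rho eps delta mu O.
Hypothesis iid : iid_seeds mu P T xi.
Hypothesis delta_le1 : delta <= 1.

Let weights t w := (lp_state A b rho alpha s O (fun i => xi i w) t).2.

(** With [is_distr] the event is a preimage of the set that [bounded_oracle] declares measurable. *)
Definition round_success t : set Omega := [set w |
  is_distr (weights t w) /\
  oracle_success A b K rho eps (weights t w) (O (weights t w) (xi t w))].

Lemma measurable_round_success t : measurable (round_success t).
Proof.
have [mO mG _] := oracle.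
have [_ my] := @measurable_lp_state R _ Omega m d A b rho alpha s _ Seed O
  (fun w i => xi i w) s_gt0 s_le_m mO t (fun i _ => measurable_funPT (xi i)).
have := measurable_fun_pair my (measurable_funPT (xi t)).
by move=> /(_ measurableT _ mG); rewrite setTI.
Qed.

Lemma round_success_ge t : (t < T)%N ->
  ((1 - delta)%:E <= P (round_success t))%E.
Proof.
move=> tT; have [mO mG succ] := oracle.
pose hist := g_sigma_algebraType (history xi t).
have [_ my] := @measurable_lp_state R _ hist m d A b rho alpha s _ Seed O
  (fun w i => xi i w) s_gt0 s_le_m mO t (fun i it => measurable_seed_history it).
(* The past is encoded as the identity into [Omega] with the coarser sigma-algebra: the weights are
   measurable for it and seed [t] is independent of it. *)
pose X : {mfun Omega >-> hist} :=
  HB.pack (fun w : Omega => w : hist)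
    (isMeasurableFun.Build _ _ _ _ _ (@measurable_id_history _ _ _ _ xi t)).
pose S : set (hist * Seed) := [set p | is_distr (weights t p.1) /\
  oracle_success A b K rho eps (weights t p.1) (O (weights t p.1) p.2)].
have mS : measurable S.
  have mp : measurable_fun [set: hist * Seed] (fun p => (weights t p.1, p.2)).
    by apply: measurable_fun_pair => //; exact: (measurableT_comp my measurable_fst).
  by have := mp measurableT _ mG; rewrite setTI.
apply: (@le_probability_section _ _ _ _ _ _ _ P mu X (xi t) S) => //.
- move=> H C mH mC; exact: (history_indep iid tT mH mC).
- by rewrite subr_ge0.
- move=> w; have yd := dense_pair_distr
    (dense_pair_lp_state A b rho alpha s_gt0 s_le_m O (fun i => xi i w) t).
  rewrite (_ : xsection S (X w) = [set v |
    oracle_success A b K rho eps (weights t w) (O (weights t w) v)]).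
    exact: succ.
  by apply/seteqP; split=> v; rewrite /xsection/= inE => // -[].
Qed.
End success.

(** * Assembly of the probabilistic and deterministic parts *)

Theorem theorem11 (R : realType) (m d : nat)
    (A : 'M[R]_(m, d)) (b : 'cV[R]_m) (K : set 'cV[R]_d)
    (rho alpha beta : R) (s : nat)
    (dS : measure_display) (Seed : measurableType dS) (mu : probability Seed R)
    (O : 'cV[R]_m -> Seed -> 'cV[R]_d)
    (dO : measure_display) (Omega : measurableType dO)
    (P : probability Omega R) (xi : nat -> {mfun Omega >-> Seed}) :
  convex_set K ->
  (forall x, K x -> `| A *m x - b | <= rho) ->
  0 < alpha -> alpha <= 9 * rho ->
  0 < beta -> beta < 1 ->
  (0 < s)%N -> (s <= m)%N ->
  (exists2 x, K x & forall i, (A *m x) i 0 <= b i 0) ->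
  bounded_oracle A b K rho (alpha / 3) (beta / (lp_rounds m rho alpha)%:R) mu O ->
  iid_seeds mu P (lp_rounds m rho alpha) xi ->
  exists2 E : set Omega, measurable E &
    ((1 - beta)%:E <= P E)%E /\
    (forall w, E w ->
      let xbar := dense_mw_lp A b rho alpha s O (fun t => xi t w) in
      K xbar /\
      exists S : {set 'I_m}, (#|S| < s)%N /\
        forall i, i \notin S -> (A *m xbar) i 0 <= b i 0 + alpha).
Proof.
move=> cK _ alpha0 alpha_rho beta0 beta1 s0 sm feas oracle iid.
have rho0 : 0 < rho by lra.
set T := lp_rounds m rho alpha in oracle iid *.
have T0 : 0 < T%:R :> R by rewrite ltr0n lp_rounds_gt0.
(* This keeps the success bound of each call nonnegative, as the Fubini argument requires. *)
have delta1 : beta / T%:R <= 1.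
  rewrite ler_pdivrMr// mul1r (le_trans (ltW beta1))//.
  by rewrite ler1n lp_rounds_gt0.
pose F := round_success A b K rho alpha (alpha / 3) s O xi.
have mF t : measurable (F t) by exact: measurable_round_success oracle t.
exists (\bigcap_(t < T) F t).
  by apply: fin_bigcap_measurable => //; exact: finite_II.
split=> [|w Fw].
  have {1}-> : beta = T%:R * (beta / T%:R).
    by rewrite mulrC divfK// gt_eqF.
  apply: probability_bigcap_ge => // t tT.
  exact: (round_success_ge _ _ _ oracle iid).
by apply: dense_mw_lp_correct => // t /Fw[].
Qed.
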